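(* Let $f:\mathbb{R}^d\to\mathbb{R}$ be twice continuously differentiable and bounded below, with gradient $g(x)=\nabla f(x)$ and Hessian $H(x)=\nabla^2 f(x)$. For each $x\in\mathbb{R}^d$ let $\tilde H(x)$ be a symmetric matrix (an inexact Hessian). Assume: (i) there exists $0\le L_2<\infty$ such that for all $x\in\mathbb{R}^d$ and $t\ge0$, $\|H(x-t\,g(x))-H(x)\|\le t\,L_2\|g(x)\|$; (ii) for some (arbitrary) $\Delta_H\ge0$, $|\langle g(x),(H(x)-\tilde H(x))g(x)\rangle|\le\Delta_H\|g(x)\|^2$ for all $x\in\mathbb{R}^d$; (iii) there exists $0\le\tilde L_1<\infty$ such that $\|\tilde H(x)g(x)\|\le\tilde L_1\|g(x)\|$ for all $x\in\mathbb{R}^d$. Consider scaled gradient descent with line search using $\tilde H$ in place of $H$ (defined in the context), started at $x_0\in\mathbb{R}^d$ with termination tolerance $\varepsilon_g$. Then there is a constant $C$, independent of $\varepsilon_g$ (depending only on the problem and on the other parameters, including $\Delta_H$), such that for every $0<\varepsilon_g<1$ there is an integer $K\le C\varepsilon_g^{-2}$ (i.e. $K\in\mathcal{O}(\varepsilon_g^{-2})$) such that after at most $K$ iterations one has $\|g(x_k)\|\le\varepsilon_g$ for some $0\le k\le K$.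
   Context: Vector norms are Euclidean, matrix norms are spectral. Hessian-aware scaling selection: the inputs are a vector $g\in\mathbb{R}^d$, a symmetric matrix $A\in\mathbb{R}^{d\times d}$ (the exact or inexact Hessian) and $\sigma>0$, with fixed constants $s^{\rm LPC}_{\min}\in(0,1/\sigma)$ and $0<s^{\rm NC}_{\min}\le s^{\rm NC}_{\max}<\infty$. It returns $p=-s\,g$ and a flag, where: (SPC) if $\langle g,Ag\rangle>\sigma\|g\|^2$, then $s$ is any one of $s^{\rm MR}=\frac{\langle g,Ag\rangle}{\|Ag\|^2}$, $s^{\rm CG}=\frac{\|g\|^2}{\langle g,Ag\rangle}$, $s^{\rm GM}=\frac{\|g\|}{\|Ag\|}$; (LPC) if $0\le\langle g,Ag\rangle\le\sigma\|g\|^2$, then $s$ is any number in $[s^{\rm LPC}_{\min},1/\sigma]$; (NC) if $\langle g,Ag\rangle<0$, then $s$ is any number in $[s^{\rm NC}_{\min},s^{\rm NC}_{\max}]$. Armijo condition at $x$ along $p$ with step size $\alpha$: $f(x+\alpha p)\le f(x)+\rho\,\alpha\,\langle p,g(x)\rangle$, where $\rho\in(0,1/2)$ is fixed. Backtracking line search (parameter $\theta\in(0,1)$, initial step $\alpha^0$): set $\alpha=\alpha^0$; while the Armijo condition fails replace $\alpha$ by $\theta\alpha$; return $\alpha$. Forward/backward tracking line search: set $\alpha=\alpha^0$; if the Armijo condition fails at $\alpha$, run backtracking; otherwise, while the Armijo condition holds at $\alpha$ replace $\alpha$ by $\alpha/\theta$, and finally return $\theta\alpha$. Scaled gradient descent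 with line search (inexact Hessian): given $\rho\in(0,1/2)$, $\varepsilon_g>0$, $x_0$, for $k=0,1,2,\dots$ and while $\|g(x_k)\|\ge\varepsilon_g$: obtain $p_k$ and the flag from the scaling selection with inputs $g(x_k)$, $A=\tilde H(x_k)$, $\sigma$; if the flag is SPC or LPC choose $\alpha_k\in(0,1]$ by backtracking with $\alpha^0=1$; if the flag is NC choose $\alpha_k\in(0,\infty)$ by forward/backward tracking with $\alpha^0=1$; set $x_{k+1}=x_k+\alpha_kp_k$. *)

(* Defs.v *)
From HB Require Import structures.
From mathcomp Require Import all_boot all_order all_algebra.
From mathcomp Require Import all_classical all_reals all_analysis.

Set Implicit Arguments.
Unset Strict Implicit.
Unset Printing Implicit Defensive.

Import Order.TTheory GRing.Theory Num.Theory.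
Import numFieldNormedType.Exports.
Local Open Scope classical_set_scope.
Local Open Scope ring_scope.

(* The library's norm `|_| on matrices is the max norm: it is used below only
   through the topology it induces. *)
Definition dot (R : realType) (d : nat) (u v : 'cV[R]_d) : R :=
  \sum_(i < d) u i 0 * v i 0.

Definition enorm (R : realType) (d : nat) (u : 'cV[R]_d) : R :=
  Num.sqrt (dot u u).

Definition spectral_norm (R : realType) (d : nat) (A : 'M[R]_d) : R :=
  sup [set enorm (A *m u) | u in [set u : 'cV[R]_d | enorm u <= 1]].

Definition grad (R : realType) (d : nat) (f : 'cV[R]_d -> R)
    (x : 'cV[R]_d) : 'cV[R]_d :=
  \col_(i < d) 'D_(delta_mx i 0) f x.

Definition hess (R : realType) (d : nat) (f : 'cV[R]_d -> R)
    (x : 'cV[R]_d) : 'M[R]_d :=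
  \matrix_(i < d, j < d) 'D_(delta_mx i 0) (fun y => grad f y j 0) x.

(* 'D_v is total, so differentiability is what makes grad and hess meaningful. *)
Definition twice_continuously_differentiable (R : realType) (d : nat)
    (f : 'cV[R]_d -> R) : Prop :=
  [/\ forall x, differentiable f x,
      forall x, differentiable (grad f) x
    & continuous (hess f)].

Inductive flag := SPC | LPC | NC.

(* The selection returns the direction - (s *: g) together with the flag; it is
   a relation because s may be any admissible value. *)
Definition scaling_selection (R : realType) (d : nat)
    (sigma sLPCmin sNCmin sNCmax : R) (g : 'cV[R]_d) (A : 'M[R]_d)
    (fl : flag) (p : 'cV[R]_d) : Prop :=
  exists2 s : R, p = - (s *: g) &
    match fl with
    | SPC => sigma * enorm g ^+ 2 < dot g (A *m g) /\
        [\/ s = dot g (A *m g) / enorm (A *m g) ^+ 2,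
            s = enorm g ^+ 2 / dot g (A *m g)
          | s = enorm g / enorm (A *m g)]
    | LPC => 0 <= dot g (A *m g) <= sigma * enorm g ^+ 2 /\
        sLPCmin <= s <= sigma^-1
    | NC => dot g (A *m g) < 0 /\ sNCmin <= s <= sNCmax
    end.

Definition armijo (R : realType) (d : nat) (rho : R) (f : 'cV[R]_d -> R)
    (x p : 'cV[R]_d) (alpha : R) : bool :=
  f (x + alpha *: p) <= f x + rho * alpha * dot p (grad f x).

(* The loops are given by their big-step semantics: [backtracking P theta a b]
   says that the loop entered with current step a terminates and returns b; a
   loop that runs forever is related to no b. *)
Inductive backtracking (R : realType) (P : pred R) (theta : R) : R -> R -> Prop :=
| backtracking_stop a : P a -> backtracking P theta a a
| backtracking_shrink a b :
    ~~ P a -> backtracking P theta (theta * a) b -> backtracking P theta a b.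

Inductive forward_tracking (R : realType) (P : pred R) (theta : R) :
    R -> R -> Prop :=
| forward_tracking_stop a : ~~ P a -> forward_tracking P theta a (theta * a)
| forward_tracking_grow a b :
    P a -> forward_tracking P theta (a / theta) b -> forward_tracking P theta a b.

Definition forward_backward_tracking (R : realType) (P : pred R) (theta : R)
    (a0 b : R) : Prop :=
  if P a0 then forward_tracking P theta a0 b else backtracking P theta a0 b.

Definition line_search (R : realType) (P : pred R) (theta : R) (fl : flag)
    (alpha : R) : Prop :=
  match fl with
  | SPC | LPC => backtracking P theta 1 alpha
  | NC => forward_backward_tracking P theta 1 alpha
  end.

(* One iteration from x: the outcome is [Some y] if the line search returns and
   y is the next iterate, and [None] if the line search does not terminate. *)
Definition iteration (R : realType) (d : nat)
    (rho theta sigma sLPCmin sNCmin sNCmax : R)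
    (f : 'cV[R]_d -> R) (Ht : 'cV[R]_d -> 'M[R]_d)
    (x : 'cV[R]_d) (next : option 'cV[R]_d) : Prop :=
  exists (fl : flag) (p : 'cV[R]_d),
    scaling_selection sigma sLPCmin sNCmin sNCmax (grad f x) (Ht x) fl p /\
    match next with
    | Some y => exists2 alpha : R,
        line_search (armijo rho f x p) theta fl alpha & y = x + alpha *: p
    | None => forall alpha : R, ~ line_search (armijo rho f x p) theta fl alpha
    end.

(* [xs k = Some x] means that x is the k-th iterate.  Nothing is required of
   [xs] after the algorithm has stopped, or after a line search that does not
   terminate. *)
Definition scaled_gradient_descent (R : realType) (d : nat)
    (rho theta sigma sLPCmin sNCmin sNCmax eps : R)
    (f : 'cV[R]_d -> R) (Ht : 'cV[R]_d -> 'M[R]_d)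
    (x0 : 'cV[R]_d) (xs : nat -> option 'cV[R]_d) : Prop :=
  xs 0%N = Some x0 /\
  forall (k : nat) (x : 'cV[R]_d), xs k = Some x -> eps <= enorm (grad f x) ->
    iteration rho theta sigma sLPCmin sNCmin sNCmax f Ht x (xs k.+1).

(* Main.v *)
Require Import Defs.
From HB Require Import structures.
From mathcomp Require Import all_boot all_order all_algebra.
From mathcomp Require Import all_classical all_reals all_analysis.
From mathcomp Require Import ring lra.

Set Implicit Arguments.
Unset Strict Implicit.
Unset Printing Implicit Defensive.

Import Order.TTheory GRing.Theory Num.Theory.
Import numFieldNormedType.Exports.
Local Open Scope classical_set_scope.
Local Open Scope ring_scope.

(** Every iteration decreases [f] by at least [c * eps ^+ 2] with [c > 0]
    independent of [eps] and of the iterate; as [f] is bounded below, at most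
    [(f x0 - low) / c * eps ^- 2] iterations can start from a point whose
    gradient has norm at least [eps].

    Write [g] for the gradient at the current point [x], and [t] for the length
    multiplying [- g] in the step, i.e. the line-search parameter times the
    scaling [s]. Three facts give the decrease.
    - Along the ray [x - r *: g] the curvature of [f] in the direction [g] is at
      most [(Lt1 + DeltaH + r * L2 * enorm g) * enorm g ^+ 2]
      ([curvature_along_gradient]), so Armijo's condition holds as soon as
      [t * (1 + enorm g) <= tau] for a constant [tau]
      ([short_gradient_steps_decrease]).
    - Hence the line search returns: short steps are accepted, and long ones are
      rejected because [f] is bounded below. The step that it returns is either
      at least 1 or at least [theta] times the guaranteed threshold
      ([line_search_correct]).
    - The scaling [s] is bounded below by a positive constant, whatever the flag
      ([scaling_lower_bound]).

    Thus [t * (1 + enorm g) >= m] for a constant [m > 0], and Armijo's condition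
    at [t] gives the decrease because
    [enorm g ^+ 2 / (1 + enorm g) >= eps ^+ 2 / 2] when [eps <= enorm g] and
    [eps < 1] ([iteration_sufficient_decrease]). *)

(** * Euclidean geometry *)

Lemma dotC (R : realType) (d : nat) (u v : 'cV[R]_d) : dot u v = dot v u.
Proof. by apply: eq_bigr => i _; rewrite mulrC. Qed.

Lemma dotDl (R : realType) (d : nat) (u v w : 'cV[R]_d) :
  dot (u + v) w = dot u w + dot v w.
Proof. by rewrite /dot -big_split; apply: eq_bigr => i _; rewrite mxE mulrDl. Qed.

Lemma dotZl (R : realType) (d : nat) (a : R) (u v : 'cV[R]_d) :
  dot (a *: u) v = a * dot u v.
Proof. by rewrite /dot mulr_sumr; apply: eq_bigr => i _; rewrite mxE mulrA. Qed.

Lemma dotNl (R : realType) (d : nat) (u v : 'cV[R]_d) : dot (- u) v = - dot u v.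
Proof. by rewrite -scaleN1r dotZl mulN1r. Qed.

Lemma dotDr (R : realType) (d : nat) (u v w : 'cV[R]_d) :
  dot w (u + v) = dot w u + dot w v.
Proof. by rewrite dotC dotDl !(dotC w). Qed.

Lemma dotZr (R : realType) (d : nat) (a : R) (u v : 'cV[R]_d) :
  dot u (a *: v) = a * dot u v.
Proof. by rewrite dotC dotZl dotC. Qed.

Lemma dotNr (R : realType) (d : nat) (u v : 'cV[R]_d) : dot u (- v) = - dot u v.
Proof. by rewrite dotC dotNl dotC. Qed.

Lemma dot_ge0 (R : realType) (d : nat) (u : 'cV[R]_d) : 0 <= dot u u.
Proof. by apply: sumr_ge0 => i _; rewrite -expr2 sqr_ge0. Qed.

Lemma enorm_ge0 (R : realType) (d : nat) (u : 'cV[R]_d) : 0 <= enorm u.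
Proof. exact: sqrtr_ge0. Qed.

Lemma sqr_enorm (R : realType) (d : nat) (u : 'cV[R]_d) : enorm u ^+ 2 = dot u u.
Proof. by rewrite sqr_sqrtr// dot_ge0. Qed.

Lemma enormZ (R : realType) (d : nat) (a : R) (u : 'cV[R]_d) :
  0 <= a -> enorm (a *: u) = a * enorm u.
Proof.
move=> a0; rewrite /enorm dotZl dotZr mulrA -expr2 sqrtrM ?sqr_ge0//.
by rewrite sqrtr_sqr ger0_norm.
Qed.

Lemma enorm_eq0 (R : realType) (d : nat) (u : 'cV[R]_d) : enorm u = 0 -> u = 0.
Proof.
move=> u0; have := sqr_enorm u; rewrite u0 expr0n/= => /esym/eqP.
rewrite psumr_eq0 => [/allP u0'|i _]; last by rewrite -expr2 sqr_ge0.
apply/colP => i; rewrite mxE; apply/eqP.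
by have := u0' i (mem_index_enum i); rewrite -expr2 sqrf_eq0.
Qed.

(** Cauchy-Schwarz, from the nonnegativity of the squared norm of
    [dot v v *: u - dot u v *: v]. *)
Lemma dot_le_enorm (R : realType) (d : nat) (u v : 'cV[R]_d) :
  dot u v <= enorm u * enorm v.
Proof.
have [v0|v0] := eqVneq (enorm v) 0.
  rewrite v0 mulr0 (enorm_eq0 v0) /dot big1// => i _.
  by rewrite mxE mulr0.
have vp : 0 < dot v v by rewrite -sqr_enorm exprn_gt0// lt_def v0 enorm_ge0.
apply: le_trans (ler_norm _) _.
rewrite -ler_sqr ?nnegrE ?mulr_ge0 ?enorm_ge0// exprMn !sqr_enorm real_normK ?num_real//.
rewrite -subr_ge0 -(pmulr_lge0 _ vp).
have := dot_ge0 (dot v v *: u - dot u v *: v).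
rewrite !(dotDl, dotDr, dotNl, dotNr, dotZl, dotZr) (dotC v u).
by congr (0 <= _); ring.
Qed.

(** The supremum defining the spectral norm is over a bounded set: by
    Cauchy-Schwarz on each row, the Frobenius norm is an upper bound. *)
Lemma enorm_mulmx_le (R : realType) (d : nat) (A : 'M[R]_d) (u : 'cV[R]_d) :
  enorm (A *m u) <= spectral_norm A * enorm u.
Proof.
have bnd : has_ubound [set enorm (A *m v) | v in [set v : 'cV[R]_d | enorm v <= 1]].
  exists (Num.sqrt (\sum_i dot (row i A)^T (row i A)^T)) => _ [v /= v1 <-].
  apply: ler_wsqrtr; apply: ler_sum => i _.
  have -> : (A *m v) i 0 = dot (row i A)^T v.
    by rewrite mxE; apply: eq_bigr => j _; rewrite !mxE.
  rewrite -!expr2 -sqr_enorm -real_normK ?num_real//.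
  rewrite ler_sqr ?nnegrE ?enorm_ge0// ler_norml.
  have cs w : enorm w <= 1 -> dot (row i A)^T w <= enorm (row i A)^T.
    move=> w1; apply: le_trans (dot_le_enorm _ _) _.
    by rewrite ler_piMr ?enorm_ge0.
  rewrite cs// andbT lerNl -dotNr cs//.
  by rewrite /enorm dotNl dotNr opprK.
have [u0|u0] := eqVneq (enorm u) 0.
  rewrite u0 mulr0 (enorm_eq0 u0) mulmx0 /enorm /dot big1 ?sqrtr0// => i _.
  by rewrite mxE mulr0.
have up : 0 < enorm u by rewrite lt_def u0 enorm_ge0.
have inv0 : 0 <= (enorm u)^-1 by rewrite invr_ge0 ltW.
rewrite -ler_pdivrMr// mulrC -enormZ// scalemxAr.
apply: (ub_le_sup bnd); exists ((enorm u)^-1 *: u) => //=.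
by rewrite enormZ// mulVf.
Qed.

Lemma dot_mulmx_le (R : realType) (d : nat) (A : 'M[R]_d) (u : 'cV[R]_d) :
  dot u (A *m u) <= spectral_norm A * enorm u ^+ 2.
Proof.
apply: le_trans (dot_le_enorm _ _) _.
rewrite [X in _ <= _ * X]expr2 mulrA [X in _ <= X]mulrC.
by apply: ler_wpM2l; rewrite ?enorm_ge0// enorm_mulmx_le.
Qed.

(** * Calculus along a line *)

Lemma derive_dot_grad (R : realType) (d : nat) (f : 'cV[R]_d -> R)
    (x v : 'cV[R]_d) :
  differentiable f x -> 'D_v f x = dot v (grad f x).
Proof.
move=> df; rewrite deriveE// {1}(matrix_sum_delta v) linear_sum.
apply: eq_bigr => i _; rewrite big_ord1 linearZ/= !mxE deriveE//.
Qed.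

Lemma is_derive_line (R : realType) (d : nat) (h : 'cV[R]_d -> R)
    (x v : 'cV[R]_d) (t l : R) :
  is_derive (t *: v + x) v h l -> is_derive t 1 (fun s : R => h (s *: v + x)) l.
Proof.
case=> dh dl.
have E : (fun s : R => s^-1 *: (((fun r : R => h (r *: v + x)) \o shift t) (s *: 1)
    - h (t *: v + x))) =
  (fun s : R => s^-1 *: ((h \o shift (t *: v + x)) (s *: v) - h (t *: v + x))).
  apply/funext => s /=; congr (_ *: (h _ - _)).
  by rewrite scalerDl addrA /GRing.scale/= mulr1.
by split; rewrite /derivable /derive E.
Qed.

Lemma derive_grad_hess (R : realType) (d : nat) (f : 'cV[R]_d -> R)
    (x v u : 'cV[R]_d) :
  differentiable (grad f) x ->
  is_derive x v (fun y => dot u (grad f y)) (dot v (hess f x *m u)).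
Proof.
move=> dg.
have dgj j : differentiable (fun y => grad f y j 0) x.
  apply: (@differentiable_comp _ _ _ _ (grad f) (fun N : 'cV[R]_d => N j 0)) => //.
  exact: differentiable_coord.
have -> : (fun y => dot u (grad f y)) =
    \sum_(j < d) (u j 0 \*: (fun y => grad f y j 0)).
  apply/funext => y; rewrite fct_sumE; exact: eq_bigr.
have -> : dot v (hess f x *m u) =
    \sum_(j < d) u j 0 *: 'D_v (fun y => grad f y j 0) x.
  rewrite /dot; under eq_bigr do rewrite mxE mulr_sumr.
  rewrite exchange_big; apply: eq_bigr => j _/=.
  rewrite derive_dot_grad// /GRing.scale/= /dot mulr_sumr.
  by apply: eq_bigr => i _; rewrite !mxE [RHS]mulrCA [u j 0 * _]mulrC.
apply: is_derive_sum => j; apply: is_deriveZ.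
exact/derivableP/diff_derivable.
Qed.

Lemma mean_value (R : realType) (h dh : R -> R) (a b : R) :
  a < b -> (forall s : R, is_derive s 1 h (dh s)) ->
  exists2 c, a < c < b & h b - h a = dh c * (b - a).
Proof.
move=> ab hd; have [|c] := MVT ab (fun s _ => hd s).
- by apply: derivable_within_continuous => s _; exact: ex_derive.
- by rewrite in_itv/=; exists c.
Qed.

(** Second-order expansion by two applications of the mean value theorem. This
    loses the factor 1/2 of Taylor's formula, which affects constants only. *)
Lemma second_order_upper_bound (R : realType) (d : nat) (f : 'cV[R]_d -> R)
    (x : 'cV[R]_d) (t B : R) :
  twice_continuously_differentiable f -> 0 < t ->
  (forall r, 0 <= r <= t ->
    dot (grad f x) (hess f (x - r *: grad f x) *m grad f x) <= B) ->
  0 <= B ->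
  f (x - t *: grad f x) <= f x - t * enorm (grad f x) ^+ 2 + t ^+ 2 * B.
Proof.
move=> [df dg _] t0 curv B0; set g := grad f x.
have lineE r : x - r *: g = r *: (- g) + x by rewrite scalerN addrC.
pose phi r := f (r *: (- g) + x).
pose psi r := dot (- g) (grad f (r *: (- g) + x)).
have dphi r : is_derive r (1 : R) phi (psi r).
  apply: is_derive_line; rewrite /psi -derive_dot_grad//.
  exact/derivableP/diff_derivable.
have dpsi r : is_derive r (1 : R) psi (dot g (hess f (x - r *: g) *m g)).
  rewrite lineE; apply: (@is_derive_line _ _ (fun y => dot (- g) (grad f y))).
  have := derive_grad_hess (- g) (- g) (dg (r *: (- g) + x)).
  by rewrite mulmxN dotNl dotNr opprK.
have [c /andP[c0 ct] phiE] := mean_value t0 dphi.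
have [e /andP[e0 ec] psiE] := mean_value c0 dpsi.
have := curv e; rewrite (ltW e0) (ltW (lt_trans ec ct)) => /(_ isT) qB.
have psi0 : psi 0 = - enorm g ^+ 2.
  by rewrite /psi scale0r add0r dotNl sqr_enorm.
have phi0 : phi 0 = f x by rewrite /phi scale0r add0r.
rewrite lineE -/(phi t).
rewrite psi0 subr0 in psiE; rewrite phi0 subr0 in phiE.
rewrite -/g in qB *.
set q := dot _ _ in psiE qB.
have h1 : q * c <= B * t.
  apply: (@le_trans _ _ (B * c)); first by rewrite ler_wpM2r// ltW.
  by rewrite ler_wpM2l// ltW.
have h2 : psi c * t <= (B * t - enorm g ^+ 2) * t.
  by rewrite ler_wpM2r ?(ltW t0)//; lra.
have -> : phi t = f x + psi c * t by rewrite -phiE; ring.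
have -> : f x - t * enorm g ^+ 2 + t ^+ 2 * B = f x + (B * t - enorm g ^+ 2) * t by ring.
by rewrite lerD2l.
Qed.

(** * Line searches *)

Lemma geometric_lt (R : realType) (z e : R) :
  0 < z < 1 -> 0 < e -> exists n, z ^+ n < e.
Proof.
move=> /andP[z0 z1] e0.
have /cvg_expr/cvgrPdist_lt/(_ e e0)[N _ /(_ N (leqnn N))] : `|z| < 1.
  by rewrite gtr0_norm.
by rewrite /= sub0r normrN gtr0_norm ?exprn_gt0// => ?; exists N.
Qed.

Lemma backtracking_terminates (R : realType) (P : pred R) (theta abar a : R) :
  0 < theta < 1 -> 0 < abar -> (forall b, 0 < b <= abar -> P b) -> 0 < a ->
  exists b, backtracking P theta a b.
Proof.
move=> htheta abar0 hP a0.
have [n] := geometric_lt htheta (divr_gt0 abar0 a0).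
rewrite ltr_pdivlMr// => /ltW; elim: n a a0 => [|n IH] a a0.
  by rewrite mul1r => aa; exists a; apply/backtracking_stop/hP; rewrite a0.
case/andP: (htheta) => t0 _.
rewrite exprSr -mulrA => /(IH _ (mulr_gt0 t0 a0))[b hb].
have [Pa|Pa] := boolP (P a); first by exists a; exact: backtracking_stop.
by exists b; exact: backtracking_shrink.
Qed.

(** A rejected step exceeds [abar], so the step following it exceeds
    [theta * abar]. *)
Lemma backtracking_ge (R : realType) (P : pred R) (theta abar a b : R) :
  0 < theta < 1 -> (forall b, 0 < b <= abar -> P b) -> 0 < a ->
  backtracking P theta a b -> P b /\ Num.min a (theta * abar) <= b.
Proof.
move=> /andP[t0 _] hP + hb; elim: hb => {a b} [a Pa _|a b Pa _ IH a0].
  by rewrite ge_min lexx.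
have [Pb mb] := IH (mulr_gt0 t0 a0); split=> //; apply: le_trans mb.
rewrite le_min !ge_min lexx !orbT andbT ler_pM2l//; apply/orP; right.
by rewrite leNgt; apply: contra Pa => /ltW aa; rewrite hP// a0.
Qed.

(** [P] rejects every step beyond [amax], and the growing steps pass it. *)
Lemma forward_tracking_terminates (R : realType) (P : pred R) (theta amax a : R) :
  0 < theta < 1 -> (forall b, P b -> b <= amax) -> 0 < a ->
  exists b, forward_tracking P theta a b.
Proof.
move=> htheta hP a0; case/andP: (htheta) => t0 _.
have m0 : 0 < 1 + `|amax| by rewrite ltr_wpDr.
have [n] := geometric_lt htheta (divr_gt0 a0 m0).
rewrite ltr_pdivlMr// => /ltW; elim: n a a0 => [|n IH] a a0.
  rewrite mul1r => aa; exists (theta * a); apply: forward_tracking_stop.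
  apply/negP => /hP; have := ler_norm amax; lra.
rewrite exprSr -mulrA mulrCA mulrC -ler_pdivlMr// => /(IH _ (divr_gt0 a0 t0))[b hb].
have [Pa|Pa] := boolP (P a); first by exists b; exact: forward_tracking_grow.
by exists (theta * a); exact: forward_tracking_stop.
Qed.

(** The invariant is that the step preceding the current one, [theta * a], was
    accepted and is at least 1: it is what the loop returns. *)
Lemma forward_tracking_ge (R : realType) (P : pred R) (theta a b : R) :
  0 < theta < 1 -> P (theta * a) -> 1 <= theta * a ->
  forward_tracking P theta a b -> P b /\ 1 <= b.
Proof.
move=> /andP[t0 t1] + + hb; elim: hb => {a b} [a Pa //|a b Pa _ IH _ a1].
have E : theta * (a / theta) = a by rewrite mulrC divfK// gt_eqF.
have a0 : 0 < a by rewrite -(pmulr_rgt0 _ t0); exact: lt_le_trans a1.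
rewrite E in IH; apply: IH => //; apply: le_trans a1 _.
by rewrite ger_pMl// ltW.
Qed.

Lemma line_search_correct (R : realType) (P : pred R) (theta abar amax : R)
    (fl : flag) :
  0 < theta < 1 -> 0 < abar -> (forall b, 0 < b <= abar -> P b) ->
  (forall b, P b -> b <= amax) ->
  (exists b, line_search P theta fl b) /\
  (forall b, line_search P theta fl b -> P b /\ Num.min 1 (theta * abar) <= b).
Proof.
move=> ht abar0 hP hmax.
have bt := backtracking_terminates ht abar0 hP ltr01.
have bg b := @backtracking_ge _ P theta abar 1 b ht hP ltr01.
case: fl => //=; rewrite /forward_backward_tracking.
have [P1|//] := boolP (P 1).
split=> [|b hb]; first exact: forward_tracking_terminates hmax ltr01.
suff [Pb b1] : P b /\ 1 <= b by rewrite ge_min b1.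
case/andP: (ht) => t0 _.
have E : theta * (1 / theta) = 1 by rewrite mulrC divfK// gt_eqF.
(* The invariant of the forward loop may fail at the initial step 1, whose
   predecessor is [theta]; it holds after one round, which [P 1] triggers. *)
inversion hb as [a nP1|a c _ hc]; first by rewrite P1 in nP1.
by apply: forward_tracking_ge hc; rewrite ?E.
Qed.

(** * One iteration *)

Lemma armijo_gradE (R : realType) (d : nat) (rho : R) (f : 'cV[R]_d -> R)
    (x : 'cV[R]_d) (s a : R) :
  armijo rho f x (- (s *: grad f x)) a =
  (f (x - (a * s) *: grad f x) <= f x - rho * (a * s) * enorm (grad f x) ^+ 2).
Proof.
rewrite /armijo dotNl dotZl -sqr_enorm scalerN scalerA.
by congr (_ <= _ + _); ring.
Qed.

(** In the strong-curvature case [dot g (A *m g)] lies between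
    [sigma * enorm g ^+ 2] and [L * enorm g ^+ 2], and [enorm (A *m g)] is at most
    [L * enorm g]; each of the three candidates is a quotient of such
    quantities. The constant [smin] does not depend on [g] or [A]. *)
Lemma scaling_lower_bound (R : realType) (sigma sLPCmin sNCmin sNCmax L : R) :
  0 < sigma -> 0 < sLPCmin -> 0 < sNCmin -> 0 <= L ->
  exists2 smin, 0 < smin &
    forall (d : nat) (g : 'cV[R]_d) (A : 'M[R]_d) (fl : flag) (p : 'cV[R]_d),
      0 < enorm g -> enorm (A *m g) <= L * enorm g ->
      scaling_selection sigma sLPCmin sNCmin sNCmax g A fl p ->
      exists2 s, smin <= s & p = - (s *: g).
Proof.
move=> sigma0 l0 n0 L0.
(* [L] may vanish, and the bound divides by it. *)
pose L' := L + 1.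
have L'0 : 0 < L' by rewrite /L'; lra.
have L'2 : 0 < L' ^+ 2 by rewrite exprn_gt0.
exists (Num.min (Num.min (sigma / L' ^+ 2) L'^-1) (Num.min sLPCmin sNCmin)).
  by rewrite !lt_min l0 n0 divr_gt0// invr_gt0 L'0.
move=> d g A fl p g0 AgL [s pE hs]; exists s => //.
case: fl hs => [[]|[_ /andP[ls _]]|[_ /andP[ns _]]]; last 2 first.
- by rewrite !ge_min ls !orbT.
- by rewrite !ge_min ns !orbT.
have := dot_le_enorm g (A *m g).
set G := enorm g in g0 AgL *; set N := enorm _ in AgL *; set q := dot _ _.
move=> qGN sq hs.
have G2 : 0 < G ^+ 2 by rewrite exprn_gt0.
have q0 : 0 < q by apply: lt_trans sq; rewrite mulr_gt0.
have N0 : 0 < N by rewrite -(pmulr_rgt0 _ g0); exact: lt_le_trans qGN.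
have NL : N <= L' * G by apply: le_trans AgL _; rewrite ler_wpM2r ?ltW// /L'; lra.
case: hs => ->; rewrite !ge_min.
- suff -> : sigma / L' ^+ 2 <= q / N ^+ 2 by [].
  rewrite ler_pdivlMr ?exprn_gt0// mulrAC ler_pdivrMr//.
  have N2 : N ^+ 2 <= G ^+ 2 * L' ^+ 2.
    by rewrite -exprMn (mulrC G) ler_pXn2r// nnegrE ltW// mulr_gt0.
  apply: le_trans (ler_wpM2l (ltW sigma0) N2) _.
  by rewrite mulrA ler_wpM2r// ltW.
- suff -> : L'^-1 <= G ^+ 2 / q by rewrite orbT.
  rewrite ler_pdivlMr// mulrC ler_pdivrMr//.
  apply: le_trans qGN _; rewrite expr2 -mulrA ler_pM2l// mulrC//.
- suff -> : L'^-1 <= G / N by rewrite orbT.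
  by rewrite ler_pdivlMr// mulrC ler_pdivrMr// mulrC.
Qed.

(** Split the Hessian at [x - r *: g] into its variation along the ray, the
    inexactness of [A] at [x], and [A] itself. *)
Lemma curvature_along_gradient (R : realType) (d : nat) (f : 'cV[R]_d -> R)
    (A : 'M[R]_d) (x : 'cV[R]_d) (L2 DeltaH Lt1 r : R) :
  spectral_norm (hess f (x - r *: grad f x) - hess f x)
    <= r * L2 * enorm (grad f x) ->
  `|dot (grad f x) ((hess f x - A) *m grad f x)| <= DeltaH * enorm (grad f x) ^+ 2 ->
  enorm (A *m grad f x) <= Lt1 * enorm (grad f x) ->
  dot (grad f x) (hess f (x - r *: grad f x) *m grad f x)
    <= (Lt1 + DeltaH + r * L2 * enorm (grad f x)) * enorm (grad f x) ^+ 2.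
Proof.
set g := grad f x; set H' := hess f _ => hH hD hA.
have -> : H' = (H' - hess f x) + (hess f x - A) + A by rewrite addrA !subrK.
rewrite mulmxDl mulmxDl !dotDr.
have h1 : dot g ((H' - hess f x) *m g) <= r * L2 * enorm g * enorm g ^+ 2.
  by apply: le_trans (dot_mulmx_le _ _) _; rewrite ler_wpM2r ?sqr_ge0.
have h2 := le_trans (ler_norm _) hD.
have h3 : dot g (A *m g) <= Lt1 * enorm g ^+ 2.
  apply: le_trans (dot_le_enorm _ _) _.
  by rewrite expr2 mulrCA; apply: ler_wpM2l hA; rewrite enorm_ge0.
lra.
Qed.

(** Relative to the first-order decrease [t * enorm g ^+ 2], the error of the
    second-order bound is [t * (M + t * L2 * enorm g)]. The gradient may be
    unbounded, so no single step length makes this small everywhere; it is small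
    when both [t] and [t * enorm g] are, which is what bounding
    [t * (1 + enorm g)] says. *)
Lemma short_gradient_steps_decrease (R : realType) (d : nat) (f : 'cV[R]_d -> R)
    (rho M L2 : R) :
  twice_continuously_differentiable f -> rho < 1 -> 0 <= M -> 0 <= L2 ->
  (forall (x : 'cV[R]_d) (r : R), 0 <= r ->
    dot (grad f x) (hess f (x - r *: grad f x) *m grad f x)
      <= (M + r * L2 * enorm (grad f x)) * enorm (grad f x) ^+ 2) ->
  exists2 tau, 0 < tau & forall (x : 'cV[R]_d) (t : R),
    0 < t -> t * (1 + enorm (grad f x)) <= tau ->
    f (x - t *: grad f x) <= f x - rho * t * enorm (grad f x) ^+ 2.
Proof.
move=> hf rho1 M0 L20 curv.
have B0 : 0 < M + L2 + 1 by lra.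
exists (Num.min 1 ((1 - rho) / (M + L2 + 1))).
  by rewrite lt_min ltr01/= divr_gt0// subr_gt0.
move=> x t t0; rewrite le_min ler_pdivlMr// => /andP[].
have := enorm_ge0 (grad f x); set G := enorm _ => G0 t1 tB.
have tG0 : 0 <= t * G by rewrite mulr_ge0// ltW.
have tG1 : t * G <= 1 by lra.
have K0 : 0 <= M + t * G * L2 by rewrite addr_ge0// mulr_ge0.
apply: le_trans (@second_order_upper_bound _ _ _ _ _ ((M + t * G * L2) * G ^+ 2) hf t0 _ _) _.
- move=> r /andP[r0 rt]; apply: le_trans (curv x r r0) _.
  rewrite -/G ler_wpM2r ?sqr_ge0// lerD2l (mulrAC t) ler_wpM2r//.
  by rewrite ler_wpM2r.
- by rewrite mulr_ge0// sqr_ge0.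
rewrite -/G.
have key : t * (M + t * G * L2) <= 1 - rho.
  apply: le_trans tB; apply: (@le_trans _ _ (t * (M + L2 + 1))).
    rewrite ler_wpM2l ?(ltW t0)//.
    have : t * G * L2 <= L2 by rewrite ler_piMl.
    lra.
  by rewrite ler_wpM2r ?(ltW B0)//; lra.
have tG2 : 0 <= t * G ^+ 2 by rewrite mulr_ge0 ?sqr_ge0// ltW.
have := ler_wpM2r tG2 key.
lra.
Qed.

(** Every accepted step [t] along the gradient satisfies
    [m <= t * (1 + enorm g)] for a fixed [m > 0], so Armijo's condition yields a
    decrease of at least [rho * m * enorm g ^+ 2 / (1 + enorm g)]; that quotient
    is at least of order [eps ^+ 2] whether the gradient is small or large. *)
Lemma iteration_sufficient_decrease (R : realType) (d : nat)
    (f : 'cV[R]_d -> R) (Ht : 'cV[R]_d -> 'M[R]_d)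
    (rho theta sigma sLPCmin sNCmin sNCmax tau L : R) :
  0 < rho -> 0 < theta < 1 -> 0 < sigma -> 0 < sLPCmin -> 0 < sNCmin -> 0 <= L ->
  has_lbound (range f) ->
  (forall x, enorm (Ht x *m grad f x) <= L * enorm (grad f x)) ->
  0 < tau ->
  (forall (x : 'cV[R]_d) (t : R), 0 < t -> t * (1 + enorm (grad f x)) <= tau ->
    f (x - t *: grad f x) <= f x - rho * t * enorm (grad f x) ^+ 2) ->
  exists2 c, 0 < c & forall (eps : R) (x : 'cV[R]_d) (next : option 'cV[R]_d),
    0 < eps < 1 -> eps <= enorm (grad f x) ->
    iteration rho theta sigma sLPCmin sNCmin sNCmax f Ht x next ->
    exists2 y, next = Some y & f y <= f x - c * eps ^+ 2.
Proof.
move=> rho0 htheta sigma0 l0 n0 L0 [low flow] hHt tau0 hshort.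
have [smin smin0 hsel] := scaling_lower_bound sNCmax sigma0 l0 n0 L0.
case/andP: (htheta) => t0 t1.
pose m := Num.min smin (theta * tau).
have m0 : 0 < m by rewrite lt_min smin0 mulr_gt0.
exists (rho * (m / 2)); first by rewrite mulr_gt0// divr_gt0.
move=> eps x next /andP[e0 e1] eG [fl [p [sel hnext]]].
set g := grad f x in eG sel *; set G := enorm g in eG *.
have G0 : 0 < G := lt_le_trans e0 eG.
have [s hs pE] := hsel _ _ _ _ _ G0 (hHt x) sel.
have s0 : 0 < s := lt_le_trans smin0 hs.
have G1 : 0 < 1 + G by lra.
have G2 : 0 < G ^+ 2 by rewrite exprn_gt0.
have sG : 0 < s * (1 + G) by rewrite mulr_gt0.
have rsG : 0 < rho * (s * G ^+ 2) by rewrite !mulr_gt0.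
have PE a : armijo rho f x p a = (f (x - (a * s) *: g) <= f x - rho * (a * s) * G ^+ 2).
  by rewrite pE armijo_gradE.
have abar0 : 0 < tau / (s * (1 + G)) by rewrite divr_gt0.
have Psmall a : 0 < a <= tau / (s * (1 + G)) -> armijo rho f x p a.
  case/andP=> a0; rewrite ler_pdivlMr// PE => ha; apply: hshort.
    by rewrite mulr_gt0.
  by rewrite -mulrA.
have Plarge a : armijo rho f x p a -> a <= (f x - low) / (rho * (s * G ^+ 2)).
  rewrite PE ler_pdivlMr// => ha.
  have : low <= f (x - (a * s) *: g) by apply: flow; exists (x - (a * s) *: g).
  lra.
have [[b hb] hspec] := line_search_correct fl htheta abar0 Psmall Plarge.
case: next hnext => [y [a ha ->]|/(_ b)//].
have [Pa ma] := hspec a ha.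
exists (x + a *: p) => //; apply: le_trans Pa _.
rewrite pE dotNl dotZl -sqr_enorm -/g -/G.
have mle : m <= a * s * (1 + G).
  rewrite -mulrA; apply: (@le_trans _ _ (Num.min 1 (theta * (tau / (s * (1 + G)))) * (s * (1 + G)))).
    rewrite minr_pMl ?(ltW sG)// mul1r le_min !ge_min -mulrA divfK ?gt_eqF// lexx orbT andbT.
    by rewrite (le_trans hs)// ler_peMr ?(ltW s0)//; lra.
  by rewrite ler_wpM2r// ltW.
have quot : eps ^+ 2 * (1 + G) <= 2 * G ^+ 2.
  have h1 : eps ^+ 2 <= G ^+ 2 by rewrite ler_pXn2r// nnegrE ltW.
  have h2 : eps ^+ 2 * G <= G ^+ 2.
    rewrite [leRHS]expr2 ler_wpM2r ?(ltW G0)//.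
    by apply: le_trans eG; rewrite expr2 ler_piMl// ltW.
  lra.
suff : m / 2 * eps ^+ 2 <= a * s * G ^+ 2.
  move/(ler_wpM2l (ltW rho0)); lra.
have as0 : 0 <= a * s.
  by rewrite -(pmulr_lge0 _ G1) (le_trans (ltW m0)).
have e20 := sqr_ge0 eps.
have := ler_wpM2r e20 mle; have := ler_wpM2l as0 quot.
lra.
Qed.

Theorem propositionB15 (R : realType) (d : nat)
    (f : 'cV[R]_d -> R) (Ht : 'cV[R]_d -> 'M[R]_d) (x0 : 'cV[R]_d)
    (rho theta sigma sLPCmin sNCmin sNCmax L2 DeltaH Lt1 : R)
    (hrho : 0 < rho < 1 / 2) (htheta : 0 < theta < 1) (hsigma : 0 < sigma)
    (hLPC : 0 < sLPCmin < sigma^-1)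
    (hNCmin : 0 < sNCmin) (hNCmax : sNCmin <= sNCmax)
    (hf : twice_continuously_differentiable f)
    (hlb : has_lbound (range f))
    (hHt : forall x, (Ht x)^T = Ht x)
    (hL2 : 0 <= L2)
    (hi : forall (x : 'cV[R]_d) (t : R), 0 <= t ->
      spectral_norm (hess f (x - t *: grad f x) - hess f x)
        <= t * L2 * enorm (grad f x))
    (hDeltaH : 0 <= DeltaH)
    (hii : forall x : 'cV[R]_d,
      `|dot (grad f x) ((hess f x - Ht x) *m grad f x)|
        <= DeltaH * enorm (grad f x) ^+ 2)
    (hLt1 : 0 <= Lt1)
    (hiii : forall x : 'cV[R]_d,
      enorm (Ht x *m grad f x) <= Lt1 * enorm (grad f x)) :
  exists C : R, forall eps : R, 0 < eps < 1 ->
    exists K : nat, K%:R <= C * eps ^- 2 /\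
      forall xs : nat -> option 'cV[R]_d,
        scaled_gradient_descent rho theta sigma sLPCmin sNCmin sNCmax eps
          f Ht x0 xs ->
        exists (k : nat) (x : 'cV[R]_d),
          [/\ (k <= K)%N, xs k = Some x & enorm (grad f x) <= eps].
Proof.
case/andP: hrho => rho0 rho1; case/andP: hLPC => l0 _.
have rho_lt1 : rho < 1 by lra.
have curv x r (r0 : 0 <= r) := curvature_along_gradient (hi x r r0) (hii x) (hiii x).
have [tau tau0 hshort] :=
  short_gradient_steps_decrease hf rho_lt1 (addr_ge0 hLt1 hDeltaH) hL2 curv.
have [c c0 hdec] := iteration_sufficient_decrease sNCmax rho0 htheta hsigma l0
  hNCmin hLt1 hlb hiii tau0 hshort.
case: hlb => low flow.
have low0 : low <= f x0 by apply: flow; exists x0.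
exists ((f x0 - low) / c) => eps heps; case/andP: (heps) => e0 _.
have e20 : 0 < eps ^+ 2 by rewrite exprn_gt0.
set Q := _ / c * _.
have Q0 : 0 <= Q by rewrite mulr_ge0 ?invr_ge0 ?divr_ge0 ?subr_ge0// ltW.
exists (Num.trunc Q); split; first by case/andP: (truncn_itv Q0).
move=> xs [xs0 hxs]; apply: contrapT => none.
have big k x : (k <= Num.trunc Q)%N -> xs k = Some x -> eps < enorm (grad f x).
  by move=> kK xk; rewrite ltNge; apply/negP => ?; apply: none; exists k, x.
have iter k : (k <= (Num.trunc Q).+1)%N ->
    exists2 x, xs k = Some x & f x <= f x0 - k%:R * (c * eps ^+ 2).
  elim: k => [_|k IH kK]; first by exists x0; rewrite ?mul0r ?subr0.
  have [x xk fx] := IH (ltnW kK).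
  have xbig := ltW (big k x kK xk).
  have [y yk fy] := hdec eps x _ heps xbig (hxs k x xk xbig).
  exists y => //; apply: le_trans fy _.
  rewrite -natr1; lra.
have [x _ fx] := iter _ (leqnn _).
have lowx : low <= f x by apply: flow; exists x.
have := truncnS_gt Q; rewrite ltNge => /negP; apply.
by rewrite /Q !ler_pdivlMr//; move: fx; set n := _%:R; lra.
Qed.
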